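(* There is an absolute constant $K>0$ such that for every (static) connected $d$-regular graph $G=(V,E)$ with $n$ vertices and edge-connectivity $\rho$, the maximum hitting time satisfies $$t_{\mathrm{hit}}(G)\le K n^2\left(\frac{\log d}{d}+\frac1\rho\right).$$ In particular, since $\rho\le d$, for $d\ge2$ one has $t_{\mathrm{hit}}(G)\le K n^2\,\frac{\log d}{\rho}$ (for a possibly larger absolute constant $K$).
   Context: The graph is simple and undirected. The edge-connectivity $\rho$ is the minimum of $|\partial S|$ over all $S\subseteq V$ with $1\le|S|\le n-1$, where $\partial S$ is the set of edges between $S$ and $V\setminus S$. $t_{\mathrm{hit}}(G)=\max_{u,v}\tau_{u,v}$, where $\tau_{u,v}$ is the expected time for the lazy random walk on $G$ (stays put with probability $1/2$, otherwise moves to a uniformly random neighbour) started at $u$ to first reach $v$. *)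

(* Defs.v *)
From HB Require Import structures.
From mathcomp Require Export all_boot all_order all_algebra.
From mathcomp Require Export boolp classical_sets reals constructive_ereal.
From mathcomp Require Export ereal topology normedtype sequences exp.

Set Implicit Arguments.
Unset Strict Implicit.
Unset Printing Implicit Defensive.

Import Order.TTheory GRing.Theory Num.Theory.

Local Open Scope ring_scope.

Definition simple_graph (T : finType) (e : rel T) : Prop :=
  symmetric e /\ irreflexive e.

Definition connected_graph (T : finType) (e : rel T) : Prop :=
  forall u v : T, connect e u v.

Definition degree (T : finType) (e : rel T) (v : T) : nat :=
  #|[set w | e v w]|.

Definition regular_graph (T : finType) (e : rel T) (d : nat) : Prop :=
  forall v : T, degree e v = d.

(* Each edge between S and its complement is recorded exactly once, as the
   pair oriented from S to ~: S, so the cardinal below counts undirected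
   edges. *)
Definition edge_boundary (T : finType) (e : rel T) (S : {set T}) :
    {set T * T} :=
  [set p | [&& e p.1 p.2, p.1 \in S & p.2 \notin S]].

(* The default value #|T| ^ 2 is an upper bound on every #|edge_boundary e S|,
   so it does not affect the minimum as soon as there is an admissible S, that
   is, as soon as #|T| >= 2. *)
Definition edge_connectivity (T : finType) (e : rel T) : nat :=
  \big[minn/(#|T| ^ 2)%N]_(S : {set T} | (1 <= #|S| <= #|T| - 1)%N)
    #|edge_boundary e S|.

Section LazyWalk.
Variables (R : realType) (T : finType) (e : rel T).

Definition lazy_step (x y : T) : R :=
  (x == y)%:R / 2 + (e x y)%:R / (2 * (degree e x)%:R).

(* P (X_0 = x 0, ..., X_t = x t) for the lazy walk (X_i) with X_0 = u *)
Definition walk_prob (u : T) (t : nat) (x : {ffun 'I_t.+1 -> T}) : R :=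
  (x ord0 == u)%:R *
  \prod_(i < t) lazy_step (x (widen_ord (leqnSn t) i)) (x (lift ord0 i)).

Definition first_hit (v : T) (t : nat) (x : {ffun 'I_t.+1 -> T}) : bool :=
  (x ord_max == v) && [forall i : 'I_t.+1, (i < t)%N ==> (x i != v)].

(* P (tau = t), where tau = inf {t >= 0 | X_t = v} and X_0 = u *)
Definition hit_prob (u v : T) (t : nat) : R :=
  \sum_(x : {ffun 'I_t.+1 -> T} | first_hit v x) walk_prob u x.

Local Open Scope ereal_scope.

(* E tau = sum_t t * P (tau = t) + oo * P (tau = oo), where oo * 0 = 0 *)
Definition hitting_time (u v : T) : \bar R :=
  \sum_(0 <= t <oo) (t%:R * hit_prob u v t)%:E
  + +oo * (1 - \sum_(0 <= t <oo) (hit_prob u v t)%:E).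

Definition max_hitting_time : \bar R :=
  \big[maxe/0]_(u : T) \big[maxe/0]_(v : T) hitting_time u v.

End LazyWalk.

(* Main.v *)
Require Import Defs.
From mathcomp Require Import ring lra zify.
Set Implicit Arguments.
Unset Strict Implicit.
Unset Printing Implicit Defensive.
Import Order.TTheory GRing.Theory Num.Theory.
Import numFieldNormedType.Exports.
Local Open Scope ring_scope.

(** Both bounds follow from 72 n^2 / rho (max_hitting_time_le): the term
    log d / d is nonnegative, and log d >= log 2 when d >= 2.

    Fix the target v and let tau be the hitting time of v.  The truncated mean
    h x = E_x (min (tau, N)) vanishes at v, and first-step analysis gives
    h x <= 1 + E_x (h X_1) for x <> v, that is
    sum_(y ~ x) (h x - h y) <= 2 d (truncated_mean_laplacian).  So h is the
    potential of a flow in which every vertex other than v injects at most 2 d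
    units, and the net flow out of any set that avoids v is at most 2 d n
    (cut_flow_le).  There are two consequences.
    - A level cut of h has at least rho edges, so one of them has a drop of at
      most 2 d n / rho: every interval of that length that starts between 0 and
      the maximum of h contains a value of h (crossing_vertex).
    - The flow into x, and the flow out of x, is part of the flow through a level
      cut, so sum_(y ~ x) |h y - h x| <= 4 d n (neighbour_variation_le), and at
      least half of the d neighbours of x have a potential within 8 n of h x
      (close_neighbours).
    Hence every window of length W = 16 n + 2 d n / rho below the maximum of h
    contains at least d / 2 vertices (potential_windows).  Disjoint windows
    contain disjoint sets of vertices, so at most 2 n / d windows fit below the
    maximum, and h = O ((n / d) * W) = O (n^2 / rho), because rho <= d
    (potential_le).

    Since this bound does not depend on N, the tails P (tau >= N) tend to 0, the
    walk hits v almost surely and E tau has the same bound (hitting_time_le).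
    Working with truncated means avoids having to know in advance that E tau is
    finite; the price is that the first-step equation becomes an inequality, and
    the inequality is all that the flow argument uses. *)

(** * Edge boundaries *)

Section EdgeBoundary.
Variables (T : finType) (e : rel T).

Lemma edge_connectivity_le (S : {set T}) :
  (1 <= #|S| <= #|T| - 1)%N -> (edge_connectivity e <= #|edge_boundary e S|)%N.
Proof.
move=> hS; rewrite /edge_connectivity.
elim: (index_enum _) (mem_index_enum S) => // A s IHs; rewrite in_cons big_cons.
move=> /predU1P[<-|/IHs le_s]; first by rewrite hS geq_minl.
by case: ifP => // _; apply: leq_trans le_s; rewrite geq_minr.
Qed.

Lemma edge_connectivity_le_cut (S : {set T}) (u v : T) :
  u \in S -> v \notin S -> (edge_connectivity e <= #|edge_boundary e S|)%N.
Proof.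
move=> uS vS; apply: edge_connectivity_le; apply/andP; split.
  by apply/card_gt0P; exists u.
suff : (#|S| < #|T|)%N by lia.
by rewrite -cardsT proper_card // properT; apply: contraNneq vS => ->; rewrite inE.
Qed.

Lemma edge_boundary1 (v : T) :
  irreflexive e -> #|edge_boundary e [set v]| = degree e v.
Proof.
move=> irr; rewrite /degree -(card_imset [set w | e v w] (f := pair v)); last first.
  by move=> x y [].
congr #|pred_of_set _|; apply/setP => -[a b]; rewrite !inE /=.
apply/idP/imsetP => [/and3P[ab /eqP av bv]|[w]].
  by exists b; rewrite ?inE -?av.
rewrite inE => vw [-> ->]; rewrite vw eqxx /=.
by apply: contraTneq vw => ->; rewrite irr.
Qed.

Lemma edge_connectivity_le_degree (u v : T) :
  irreflexive e -> u != v -> (edge_connectivity e <= degree e v)%N.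
Proof.
move=> irr uv; rewrite -edge_boundary1 //.
by apply: (@edge_connectivity_le_cut _ v u); rewrite inE.
Qed.

Lemma edge_connectivity_gt0 (u : T) :
  symmetric e -> connected_graph e -> (0 < edge_connectivity e)%N.
Proof.
move=> sym conn; rewrite /edge_connectivity.
apply: (big_ind (fun m => (0 < m)%N)) => [|m p m0 p0|S /andP[S0 Sn]].
- by rewrite expn_gt0; apply/orP; left; apply/card_gt0P; exists u.
- by rewrite leq_min m0.
have [x xS] : exists x, x \in S by apply/card_gt0P.
have [y yS] : exists y, y \notin S.
  have T0 : (0 < #|T|)%N by apply/card_gt0P; exists u.
  have /card_gt0P[y] : (0 < #|~: S|)%N by have := cardsC S; lia.
  by rewrite inE; exists y.
rewrite card_gt0; apply/negP => /eqP bS0.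
have clS : fingraph.closed e (mem S).
  apply: intro_closed => [|a b ab aS].
    exact: sym_connect_sym.
  apply/negPn/negP => bS.
  have : (a, b) \in edge_boundary e S by rewrite inE /= ab aS bS.
  by rewrite bS0 inE.
by move: yS; rewrite -(closed_connect clS (conn x y)) /= xS.
Qed.

End EdgeBoundary.

(** * Potentials with bounded divergence *)

Section Potential.
Variables (R : realFieldType) (T : finType) (e : rel T) (d : nat).
Hypotheses (e_sym : symmetric e) (e_reg : regular_graph e d).

(* c bounds the flow injected at each vertex other than the sink v *)
Variables (h : T -> R) (v : T) (c : R).
Hypotheses (h_ge0 : forall x, 0 <= h x) (hv0 : h v = 0) (c_gt0 : 0 < c).
Hypothesis h_div : forall x, x != v -> \sum_(y | e x y) (h x - h y) <= c.

(** The divergence of the potential difference, summed over S, leaves only the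
    edges that cross the boundary of S. *)
Lemma cut_flow_le (S : {set T}) : v \notin S ->
  \sum_(p in edge_boundary e S) (h p.1 - h p.2) <= c * #|T|%:R.
Proof.
move=> vS.
have -> : \sum_(p in edge_boundary e S) (h p.1 - h p.2) =
          \sum_(x in S) \sum_(y | e x y) (h x - h y).
  have -> : \sum_(p in edge_boundary e S) (h p.1 - h p.2) =
            \sum_(x in S) \sum_(y | e x y && (y \notin S)) (h x - h y).
    rewrite pair_big_dep /=; apply: eq_bigl => -[x y] /=.
    by rewrite inE /= andbCA.
  (* the edges inside S cancel in pairs *)
  have inner0 : \sum_(x in S) \sum_(y | e x y && (y \in S)) (h x - h y) = 0.
    set s := LHS; suff : s = - s by lra.
    rewrite {1}/s (exchange_big_dep (mem S)) /=; last by move=> x y _ /andP[].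
    rewrite /s -sumrN; apply: eq_bigr => y yS; rewrite -sumrN.
    apply: eq_big => [x|x _]; last by rewrite opprB.
    by rewrite e_sym yS andbT andbC.
  under [RHS]eq_bigr => x _ do rewrite (bigID (mem S)) /=.
  by rewrite big_split /= inner0 add0r.
apply: (@le_trans _ _ (\sum_(x in S) c)).
  by apply: ler_sum => x xS; apply: h_div; apply: contraNneq vS => <-.
rewrite sumr_const -[leLHS]mulr_natr ler_pM2l // ler_nat.
exact: max_card.
Qed.

(** The neighbours above x are joined to x through the boundary of {h > h x},
    those below x through the boundary of {h >= h x}.  On either level cut all
    the drops are nonnegative, so the part carried by the edges at x is at most
    the flow through the whole cut. *)
Lemma neighbour_variation_le (x : T) :
  \sum_(y | e x y) `|h y - h x| <= 2 * (c * #|T|%:R).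
Proof.
have cn0 : 0 <= c * #|T|%:R by rewrite mulr_ge0 // ltW.
have drop0 (p : T * T) (t : R) (S : {set T}) :
    (forall z, z \in S -> t <= h z) -> (forall z, z \notin S -> h z <= t) ->
    p \in edge_boundary e S -> 0 <= h p.1 - h p.2.
  move=> hS hS'; rewrite inE => /and3P[_ /hS h1 /hS' h2].
  by rewrite subr_ge0; apply: le_trans h2 h1.
(* a star inside a cut carries at most the whole flow of that cut *)
have star (f : T -> T * T) (S : {set T}) (P : pred T) :
    injective f -> (forall z, z \in S -> h x <= h z) ->
    (forall z, z \notin S -> h z <= h x) -> v \notin S ->
    (forall y, P y -> f y \in edge_boundary e S) ->
    \sum_(y | P y) (h (f y).1 - h (f y).2) <= c * #|T|%:R.
  move=> f_inj hS hS' vS fP; apply: le_trans (cut_flow_le vS).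
  rewrite -(big_imset (fun p => h p.1 - h p.2) (A := P) (h := f)) /=; last first.
    by move=> y z _ _; apply: f_inj.
  rewrite [leRHS](bigID (mem (f @: P))) /=.
  rewrite -[leLHS]addr0 lerD //; last first.
    by apply: sumr_ge0 => p /andP[pS _]; apply: (drop0 p (h x) S).
  rewrite le_eqVlt; apply/orP; left; apply/eqP; apply: eq_bigl => p.
  by apply/idP/andP => [pf|[]//]; split=> //; case/imsetP: pf => y Py ->; apply: fP.
have up : \sum_(y | e x y && (h x < h y)) `|h y - h x| <= c * #|T|%:R.
  rewrite (eq_bigr (fun y => h (y, x).1 - h (y, x).2)); last first.
    by move=> y /andP[_ xy]; rewrite ger0_norm // subr_ge0 ltW.
  apply: (star (fun y => (y, x)) [set z | h x < h z]).
  - by move=> a b [].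
  - by move=> z; rewrite inE => /ltW.
  - by move=> z; rewrite inE -leNgt.
  - by rewrite inE hv0 -leNgt.
  - by move=> y /andP[xy hxy]; rewrite !inE /= e_sym xy hxy ltxx.
have down : \sum_(y | e x y && ~~ (h x < h y)) `|h y - h x| <= c * #|T|%:R.
  (* for h x = 0 the set {h >= h x} would contain v, but nothing lies below x *)
  have [hx0|hx0] := ltrP 0 (h x); last first.
    rewrite big1 // => y /andP[_]; rewrite -leNgt => hyx.
    have hy0 := h_ge0 y; by have -> : h y - h x = 0; [lra | rewrite normr0].
  (* neighbours at the height of x contribute nothing *)
  rewrite (bigID (fun y => h y < h x)) /= [X in _ + X]big1 ?addr0; last first.
    move=> y /andP[/andP[_]]; rewrite -!leNgt => h1 h2.
    by have -> : h y - h x = 0; [lra | rewrite normr0].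
  rewrite (eq_bigr (fun y => h (x, y).1 - h (x, y).2)); last first.
    by move=> y /andP[_ xy]; rewrite distrC ger0_norm // subr_ge0 ltW.
  apply: (star (fun y => (x, y)) [set z | h x <= h z]).
  - by move=> a b [].
  - by move=> z; rewrite inE.
  - by move=> z; rewrite inE -ltNge => /ltW.
  - by rewrite inE hv0 -ltNge.
  - by move=> y /andP[/andP[xy _] hxy]; rewrite !inE /= xy lexx -ltNge hxy.
by rewrite (bigID (fun y => h x < h y)) /=; lra.
Qed.

(** Markov's inequality for the variation of h over the neighbours of x: at most
    half of them are farther than r from h x. *)
Lemma close_neighbours (x : T) (r : R) : 0 < r -> 4 * (c * #|T|%:R) <= d%:R * r ->
  (d <= 2 * #|[set y | (e x y) && (`|h y - h x| <= r)%R]|)%N.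
Proof.
move=> r0 hr.
have := e_reg x; rewrite /degree -sum1dep_card.
rewrite (bigID (fun y => `|h y - h x| <= r)) /= !sum1dep_card => deg.
set far := #|[set y | e x y && ~~ _]| in deg.
have : far%:R * r <= 2 * (c * #|T|%:R).
  apply: le_trans (neighbour_variation_le x).
  rewrite [leRHS](bigID (fun y => `|h y - h x| <= r)) /=.
  rewrite -[leLHS]add0r lerD //; first exact: sumr_ge0.
  rewrite mulr_natl /far -sum1dep_card -sumrMnr.
  by apply: ler_sum => y /andP[_]; rewrite -ltNge mulr1n => /ltW.
move=> far_le.
have : far%:R * 2 <= d%:R :> R by rewrite -(ler_pM2r r0); lra.
rewrite -natrM ler_nat => far2.
by set close := #|[set y | _]| in deg *; lia.
Qed.

(** Among at least k edges that carry a total flow of at most c * #|T|, one has a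
    drop of at most the average; its upper end is the vertex x. *)
Lemma crossing_vertex (u : T) (k : nat) (t : R) :
  (0 < k)%N -> (forall S : {set T}, u \in S -> v \notin S ->
    (k <= #|edge_boundary e S|)%N) ->
  0 < t <= h u ->
  exists2 x, t <= h x & h x < t + c * #|T|%:R / k%:R.
Proof.
move=> k0 hk /andP[t0 tu]; pose S := [set z | t <= h z].
have uS : u \in S by rewrite inE.
have vS : v \notin S by rewrite inE hv0 -ltNge.
set D := c * #|T|%:R / k%:R.
case: (pickP (fun p => (p \in edge_boundary e S) && (h p.1 - h p.2 <= D))).
  move=> [x y] /andP[]; rewrite !inE /= -ltNge => /and3P[_ tx yt] dxy.
  by exists x => //; lra.
move=> none; have := cut_flow_le vS; rewrite leNgt => /negP[].
have D0 : 0 <= D by rewrite divr_ge0 ?mulr_ge0 // ltW.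
have -> : c * #|T|%:R = D *+ k.
  by rewrite -[RHS]mulr_natr /D divfK // pnatr_eq0 -lt0n.
have bS := hk S uS vS.
have /card_gt0P[p0 p0S] : (0 < #|edge_boundary e S|)%N by lia.
apply: (@le_lt_trans _ _ (\sum_(p in edge_boundary e S) D)).
  by rewrite sumr_const ler_wpMn2l.
have lt_D p : p \in edge_boundary e S -> D < h p.1 - h p.2.
  by move=> pS; have := none p; rewrite pS /= leNgt => /negbT; rewrite negbK.
apply: ltr_sum => //; apply/hasP; exists p0 => //; exact: mem_index_enum.
Qed.

(** By induction on the number m of windows.  A vertex x with a potential within
    c * #|T| / k above t + r, where t is the lower end of the window, exists by
    [crossing_vertex]; its d / 2 close neighbours all stay inside the window, so
    none of them has been counted in an earlier one. *)
Lemma potential_windows (u : T) (k m : nat) (r : R) :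
  (0 < k)%N -> (forall S : {set T}, u \in S -> v \notin S ->
    (k <= #|edge_boundary e S|)%N) ->
  0 < r -> 4 * (c * #|T|%:R) <= d%:R * r ->
  m%:R * (2 * r + c * #|T|%:R / k%:R) <= h u ->
  (m * d <= 2 * #|[set z | (h z < m%:R * (2 * r + c * #|T|%:R / k%:R))%R]|)%N.
Proof.
move=> k0 hk r0 hr; set D := c * #|T|%:R / k%:R; set W := 2 * r + D.
have D0 : 0 <= D by rewrite divr_ge0 ?mulr_ge0 // ltW.
have WE : W = 2 * r + D by [].
have W0 : 0 <= W by rewrite WE; lra.
elim: m => // m IHm; rewrite -natr1 mulrDl mul1r => hm.
have mW0 : 0 <= m%:R * W by rewrite mulr_ge0.
have [|x tx xt] := crossing_vertex (t := m%:R * W + r) k0 hk.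
  by lra.
rewrite -/D in xt.
have := close_neighbours x r0 hr; set N := [set y | _] => dN.
have mdN : (m * d <= 2 * #|[set z | (h z < m%:R * W)%R]|)%N.
  by apply: IHm; lra.
set A := [set z | _] in mdN.
have : (#|A :|: N| <= #|[set z | (h z < m%:R * W + W)%R]|)%N.
  apply/subset_leq_card/fintype.subsetP => z; rewrite !inE => /orP[|/andP[_]]; first by lra.
  by rewrite ler_norml => /andP[]; lra.
have : (#|A :&: N| = 0)%N.
  apply: eq_card0 => z; rewrite !inE ler_norml; apply/negP.
  by move=> /andP[h1 /andP[_ /andP[h2 _]]]; lra.
have := cardsUI A N; rewrite mulSn => + I0; rewrite I0 addn0 => ->.
by move=> /(leq_mul (leqnn 2)); apply: leq_trans; rewrite mulnDr addnC leq_add.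
Qed.

(** With r = 4 c #|T| / d each window has length at most 9 c #|T| / k, and
    floor (2 #|T| / d) + 1 windows would contain more than #|T| vertices. *)
Lemma potential_le (u : T) (k : nat) :
  (0 < k <= d)%N -> (d <= #|T|)%N ->
  (forall S : {set T}, u \in S -> v \notin S -> (k <= #|edge_boundary e S|)%N) ->
  h u <= 36 * c * #|T|%:R ^+ 2 / (d%:R * k%:R).
Proof.
move=> /andP[k0 kd] dn hk.
have d0 : (0 < d)%N by lia.
have n0 : (0 < #|T|)%N by lia.
have dR : 0 < d%:R :> R by rewrite ltr0n.
have kR : 0 < k%:R :> R by rewrite ltr0n.
have nR : 0 < #|T|%:R :> R by rewrite ltr0n.
pose a := c * #|T|%:R; have a0 : 0 < a by rewrite mulr_gt0.
pose r := 4 * a / d%:R; have r0 : 0 < r by rewrite divr_gt0 // mulr_gt0.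
have hr : 4 * a <= d%:R * r by rewrite /r [leRHS]mulrC divfK // gt_eqF.
pose m := (2 * #|T| %/ d).+1.
have hm : (2 * #|T| < m * d)%N by rewrite /m mulSn addnC ltn_ceil.
have [hu|hu] := lerP (m%:R * (2 * r + a / k%:R)) (h u).
  have := potential_windows k0 hk r0 hr hu.
  by move=> /leq_trans /(_ (leq_mul (leqnn 2) (max_card _))); rewrite leqNgt hm.
apply: (le_trans (ltW hu)).
(* m * d <= 2 * #|T| + d, and d <= #|T| *)
have mle : m%:R <= 4 * #|T|%:R / d%:R :> R.
  rewrite ler_pdivlMr // -!natrM ler_nat.
  by rewrite /m mulSn; have := leq_trunc_div (2 * #|T|) d; lia.
have W9 : 2 * r + a / k%:R <= 9 * a / k%:R.
  have : r <= 4 * a / k%:R.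
    by rewrite /r ler_pM2l ?mulr_gt0 // lef_pV2 ?posrE // ler_nat.
  rewrite -[9 * a / _]mulrA -[4 * a / _]mulrA; lra.
apply: (@le_trans _ _ (4 * #|T|%:R / d%:R * (9 * a / k%:R))).
  by apply: ler_pM => //; rewrite addr_ge0 ?mulr_ge0 ?divr_ge0 // ltW.
rewrite le_eqVlt; apply/orP; left; apply/eqP; rewrite /a; field.
by rewrite !pnatr_eq0 -!lt0n d0 k0.
Qed.

End Potential.

(** * First-step analysis of the hitting time *)

Section FirstStep.
Variables (R : realType) (T : finType) (e : rel T).
Local Notation P := (lazy_step R e).

Lemma lazy_step_ge0 (x y : T) : 0 <= P x y.
Proof. by rewrite addr_ge0 // divr_ge0 // mulr_ge0. Qed.

Lemma sum_lazy_step (x : T) (f : T -> R) :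
  \sum_y P x y * f y =
  f x / 2 + (2 * (degree e x)%:R)^-1 * \sum_(y | e x y) f y.
Proof.
rewrite /lazy_step; under eq_bigr do rewrite mulrDl; rewrite big_split /=.
congr (_ + _).
  rewrite (bigD1 x) //= big1 ?addr0 => [|y yx]; first by rewrite eqxx mul1r mulrC.
  by rewrite eq_sym (negPf yx) !mul0r.
rewrite [in RHS]big_mkcond mulr_sumr; apply: eq_bigr => y _.
by case: (e x y); rewrite ?mul1r ?mul0r ?mulr0.
Qed.

Lemma lazy_step_sum1 (x : T) : (0 < degree e x)%N -> \sum_y P x y = 1.
Proof.
move=> deg0; have := sum_lazy_step x (fun=> 1).
rewrite (eq_bigr _ (fun y _ => mulr1 (P x y))) => ->.
have -> : \sum_(y | e x y) (1 : R) = (degree e x)%:R.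
  by rewrite /degree -sum1dep_card natr_sum.
by field; rewrite pnatr_eq0 -lt0n.
Qed.

(** Splitting off the starting point of a path, which turns the sum over paths in
    [hit_prob] into the first-step recursion. *)
Definition path_cons (t : nat) (p : T * {ffun 'I_t -> T}) : {ffun 'I_t.+1 -> T} :=
  [ffun i => oapp p.2 p.1 (unlift ord0 i)].

Lemma path_cons0 t (p : T * {ffun 'I_t -> T}) : path_cons p ord0 = p.1.
Proof. by rewrite ffunE unlift_none. Qed.

Lemma path_consS t (p : T * {ffun 'I_t -> T}) i :
  path_cons p (lift ord0 i) = p.2 i.
Proof. by rewrite ffunE liftK. Qed.

Lemma path_cons_bij t : bijective (@path_cons t).
Proof.
exists (fun x : {ffun 'I_t.+1 -> T} => (x ord0, [ffun i : 'I_t => x (lift ord0 i)])) => [[a y]|x].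
  by rewrite path_cons0; congr pair; apply/ffunP => i; rewrite ffunE path_consS.
apply/ffunP => i; rewrite ffunE.
by case: unliftP => [j ->|->]; rewrite //= ffunE.
Qed.

Lemma first_hit_cons v t (p : T * {ffun 'I_t.+1 -> T}) :
  first_hit v (path_cons p) = (p.1 != v) && first_hit v p.2.
Proof.
rewrite /first_hit.
have -> : ord_max = lift ord0 ord_max :> 'I_t.+2 by apply: val_inj.
rewrite path_consS andbCA; congr andb.
apply/forallP/andP => [all_i|[p1 /forallP all_i] i].
  split; first by have := all_i ord0; rewrite path_cons0.
  by apply/forallP => i; have := all_i (lift ord0 i); rewrite path_consS.
case: (unliftP ord0 i) => [j ->|->]; last by rewrite path_cons0 p1 implybT.
by rewrite path_consS; apply: all_i.
Qed.

Lemma walk_prob_cons u t (p : T * {ffun 'I_t.+1 -> T}) :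
  walk_prob R e u (path_cons p) =
  (p.1 == u)%:R * (P u (p.2 ord0) * walk_prob R e (p.2 ord0) p.2).
Proof.
rewrite /walk_prob big_ord_recl path_cons0 eqxx mul1r.
have [<-|] := eqVneq p.1 u; last by rewrite !mul0r.
congr (_ * (_ * _)); first by congr lazy_step; rewrite ?path_consS // -path_cons0;
  congr (path_cons p _); apply: val_inj.
apply: eq_bigr => i _; congr lazy_step; rewrite -path_consS;
  by congr (path_cons p _); apply: val_inj.
Qed.

Lemma hit_prob0 u v : hit_prob R e u v 0 = (u == v)%:R.
Proof.
pose const a := [ffun _ : 'I_1 => a] : {ffun 'I_1 -> T}.
rewrite /hit_prob (reindex const); last first.
  exists (fun x : {ffun 'I_1 -> T} => x ord0) => [a _|x _]; first by rewrite ffunE.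
  by apply/ffunP => i; rewrite ffunE (ord1 i).
rewrite (big_pred1 v) => [|a].
  by rewrite /walk_prob big_ord0 mulr1 ffunE eq_sym.
rewrite /first_hit ffunE /=; case: eqP => //= _.
by apply/forallP.
Qed.

Lemma hit_probS u v t :
  hit_prob R e u v t.+1 = (u != v)%:R * \sum_y P u y * hit_prob R e y v t.
Proof.
rewrite {1}/hit_prob (reindex (@path_cons t.+1)); last first.
  exact/onW_bij/path_cons_bij.
transitivity (\sum_(a | a != v) \sum_(x : {ffun 'I_t.+1 -> T} | first_hit v x)
   (a == u)%:R * (P u (x ord0) * walk_prob R e (x ord0) x)).
  rewrite pair_big /=; apply: eq_big => p; first exact: first_hit_cons.
  by rewrite walk_prob_cons.
rewrite big_mkcond (bigD1 u) //= [X in _ + X]big1 ?addr0; last first.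
  by move=> a au; case: ifP => // _; rewrite big1 // => x _; rewrite (negPf au) mul0r.
rewrite eqxx; case: ifP => _; last by rewrite mul0r.
rewrite mul1r /hit_prob; under [RHS]eq_bigr do rewrite mulr_sumr.
rewrite exchange_big /=; apply: eq_bigr => x _; rewrite mul1r.
rewrite [RHS](bigD1 (x ord0)) //= big1 ?addr0 // => y yx.
by rewrite /walk_prob eq_sym (negPf yx) mul0r mulr0.
Qed.

Variable v : T.

(** The probability that the walk started at x reaches v no earlier than time n,
    in the form given by the first-step recursion. *)
Fixpoint tail_prob (n : nat) (x : T) : R :=
  if n is n'.+1 then (x != v)%:R * \sum_y P x y * tail_prob n' y else 1.

(** E_x (min (tau, n)), where tau is the hitting time of v, as the sum of
    P_x (tau >= i) for 1 <= i <= n. *)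
Definition truncated_mean (n : nat) (x : T) : R := \sum_(i < n) tail_prob i.+1 x.

Lemma tail_prob_ge0 n x : 0 <= tail_prob n x.
Proof.
elim: n x => //= n IHn x; rewrite mulr_ge0 // sumr_ge0 // => y _.
by rewrite mulr_ge0 // lazy_step_ge0.
Qed.

Lemma truncated_mean_ge0 n x : 0 <= truncated_mean n x.
Proof. by apply: sumr_ge0 => i _; apply: tail_prob_ge0. Qed.

Lemma truncated_mean_target n : truncated_mean n v = 0.
Proof. by apply: big1 => i _ /=; rewrite eqxx mul0r. Qed.

Hypothesis deg_gt0 : forall x, x != v -> (0 < degree e x)%N.

Lemma tail_probS_le n x : tail_prob n.+1 x <= tail_prob n x.
Proof.
elim: n x => [|n IHn] x.
  have [->|xv] := eqVneq x v; first by rewrite /= eqxx mul0r.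
  rewrite /= xv mul1r (eq_bigr _ (fun y _ => mulr1 (P x y))).
  by rewrite lazy_step_sum1 ?deg_gt0.
rewrite [leLHS]/= [leRHS]/= ler_wpM2l // ler_sum // => y _.
by apply: ler_wpM2l (IHn y); apply: lazy_step_ge0.
Qed.

Lemma hit_prob_tail u t : hit_prob R e u v t = tail_prob t u - tail_prob t.+1 u.
Proof.
elim: t u => [|t IHt] u.
  rewrite hit_prob0 /= (eq_bigr _ (fun y _ => mulr1 (P u y))).
  have [->|uv] := eqVneq u v; first by rewrite mul0r subr0.
  by rewrite lazy_step_sum1 ?deg_gt0 // mul1r subrr.
rewrite hit_probS [tail_prob t.+1 u]/= [tail_prob t.+2 u]/= -mulrBr -sumrB.
by congr (_ * _); apply: eq_bigr => y _; rewrite IHt mulrBr.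
Qed.

Lemma hit_prob_ge0 u t : 0 <= hit_prob R e u v t.
Proof. by rewrite hit_prob_tail subr_ge0 tail_probS_le. Qed.

Lemma sum_hit_prob u n :
  \sum_(0 <= t < n) hit_prob R e u v t = 1 - tail_prob n u.
Proof.
elim: n => [|n IHn]; first by rewrite big_nil subrr.
by rewrite big_nat_recr // IHn hit_prob_tail [LHS]addrA subrK.
Qed.

(** Summation by parts, with [hit_prob_tail]. *)
Lemma sum_time_hit_prob u n :
  \sum_(0 <= t < n.+1) t%:R * hit_prob R e u v t =
  truncated_mean n u - n%:R * tail_prob n.+1 u.
Proof.
elim: n => [|n IHn].
  by rewrite big_nat1 !mul0r /truncated_mean big_ord0 subr0.
rewrite big_nat_recr // IHn hit_prob_tail /truncated_mean big_ord_recr /=.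
by rewrite -natr1; ring.
Qed.

(** For n > 0, equality holds with n - 1 instead of n on the right, and the
    truncated means increase with n. *)
Lemma truncated_mean_step n x : x != v ->
  truncated_mean n x <= 1 + \sum_y P x y * truncated_mean n y.
Proof.
move=> xv; rewrite -(lazy_step_sum1 (deg_gt0 xv)) -big_split /=.
rewrite {1}/truncated_mean.
rewrite (eq_bigr (fun i : 'I_n => \sum_y P x y * tail_prob i y)); last first.
  by move=> i _; rewrite /= xv mul1r.
rewrite exchange_big /=; apply: ler_sum => y _.
rewrite -mulr_sumr -{2}[P x y]mulr1 -mulrDr ler_wpM2l ?lazy_step_ge0 //.
(* 1 is the tail at time 0, so 1 + the truncated mean is a sum of n + 1 tails *)
rewrite -[1 + _](big_ord_recl n (fun i => tail_prob i y)) big_ord_recr /=.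
by rewrite lerDl tail_prob_ge0.
Qed.

(** The step inequality multiplied by 2 * degree e x; the lazy half of the step
    cancels half of the left-hand side. *)
Lemma truncated_mean_laplacian n x : x != v ->
  \sum_(y | e x y) (truncated_mean n x - truncated_mean n y) <=
  2 * (degree e x)%:R.
Proof.
move=> xv; set h := truncated_mean n.
have := truncated_mean_step n xv; rewrite -/h sum_lazy_step => hx.
have d0 : 0 < (degree e x)%:R :> R by rewrite ltr0n deg_gt0.
rewrite sumrB sumr_const.
have -> : #|e x| = degree e x by rewrite /degree cardsE.
set s := \sum_(y | e x y) h y in hx *.
have : h x * (2 * (degree e x)%:R) <=
    (1 + (h x / 2 + (2 * (degree e x)%:R)^-1 * s)) * (2 * (degree e x)%:R).
  by rewrite ler_pM2r // mulr_gt0.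
have -> : (1 + (h x / 2 + (2 * (degree e x)%:R)^-1 * s)) * (2 * (degree e x)%:R) =
    2 * (degree e x)%:R + h x * (degree e x)%:R + s.
  by field; rewrite gt_eqF.
by rewrite -[X in X - _]mulr_natr; lra.
Qed.

(** The tails decrease, so n * P (tau >= n) is at most the n-th truncated mean. *)
Lemma tail_prob_cvg0 u (B : R) : (forall n, truncated_mean n u <= B) ->
  (tail_prob n u @[n --> \oo] --> 0)%classic.
Proof.
move=> hB.
have anti m n : (m <= n)%N -> tail_prob n u <= tail_prob m u.
  elim: n => [|n IHn]; first by rewrite leqn0 => /eqP ->.
  rewrite leq_eqVlt => /predU1P[->//|mn].
  by apply: le_trans (tail_probS_le n u) _; apply: IHn.
rewrite -cvg_shiftS.
apply: (@squeeze_cvgr _ _ _ _ (fun=> 0) (fun n => B * harmonic n)).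
- near=> n; rewrite tail_prob_ge0 andTb /harmonic ler_pdivlMr ?ltr0n //.
  apply: le_trans (hB n.+1); rewrite mulr_natr -[X in _ *+ X]card_ord -sumr_const.
  by apply: ler_sum => i _; apply: anti.
- exact: cvg_cst.
- by rewrite -[X in (_ --> X)%classic](mulr0 B); apply: cvgMr; exact: cvg_harmonic.
Unshelve. all: by end_near. Qed.

(** Bounded truncated means force the tails to vanish, so that the walk hits v
    almost surely and the infinite part of the expectation is zero. *)
Lemma hitting_time_le u (B : R) : (forall n, truncated_mean n u <= B) ->
  (hitting_time R e u v <= B%:E)%E.
Proof.
move=> hB; rewrite /hitting_time.
have -> : (\sum_(0 <= t <oo) (hit_prob R e u v t)%:E = 1)%E.
  apply: cvg_lim => //.
  rewrite (_ : (fun n => _) = EFin \o (fun n => 1 - tail_prob n u)); last first.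
    by apply/funext => n; rewrite /= -sum_hit_prob sumEFin.
  apply: cvg_EFin; first by near=> n.
  rewrite -[X in (_ --> X)%classic]subr0; apply: cvgB; first exact: cvg_cst.
  exact: tail_prob_cvg0 hB.
rewrite subee // mule0 adde0.
apply: lime_le.
  apply: is_cvg_nneseries => n _ _.
  by rewrite lee_fin mulr_ge0 ?hit_prob_ge0.
apply: nearW => -[|n]; rewrite sumEFin lee_fin.
  by rewrite big_nil; apply: le_trans (hB 0%N); apply: truncated_mean_ge0.
rewrite sum_time_hit_prob; apply: le_trans (hB n).
by rewrite gerBl mulr_ge0 ?tail_prob_ge0.
Unshelve. all: by end_near. Qed.

End FirstStep.

(** * The bound *)

(** The potential is the truncated mean, with c = 2 d and k = rho. *)
Lemma max_hitting_time_le (R : realType) (T : finType) (e : rel T) (d : nat) :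
  simple_graph e -> connected_graph e -> regular_graph e d ->
  (max_hitting_time R e <=
    (72 * #|T|%:R ^+ 2 / (edge_connectivity e)%:R)%:E)%E.
Proof.
move=> [sym irr] conn reg; set B := 72 * _ / _.
have B0 : 0 <= B by rewrite divr_ge0 // mulr_ge0 // exprn_ge0.
have deg_gt0 v x : x != v -> (0 < degree e x)%N.
  move=> xv; apply: leq_trans (edge_connectivity_gt0 x sym conn) _.
  by apply: (edge_connectivity_le_degree (u := v)); rewrite // eq_sym.
apply: bigmax_le => [|u _]; first by rewrite lee_fin.
apply: bigmax_le => [|v _]; first by rewrite lee_fin.
apply: (hitting_time_le (deg_gt0 v)) => N.
have [->|uv] := eqVneq u v; first by rewrite truncated_mean_target.
have rho0 := edge_connectivity_gt0 u sym conn.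
have d0 : (0 < d)%N by rewrite -(reg u) (deg_gt0 v).
have := @potential_le R T e d sym reg (truncated_mean R e v N) v (2 * d%:R).
move=> /(_ _ (truncated_mean_target _ _ _ _) _ _ u (edge_connectivity e)) pot_le.
apply: le_trans (pot_le _ _ _ _ _ _) _.
- by move=> x; apply: truncated_mean_ge0.
- by rewrite mulr_gt0 // ltr0n.
- by move=> x xv; rewrite -(reg x); apply: (truncated_mean_laplacian R (deg_gt0 v)).
- by rewrite rho0 -(reg v) (edge_connectivity_le_degree (u := u)).
- by rewrite -(reg u) max_card.
- by move=> S uS vS; apply: edge_connectivity_le_cut uS vS.
rewrite le_eqVlt; apply/orP; left; apply/eqP; rewrite /B; field.
by rewrite !pnatr_eq0 -!lt0n d0 rho0.
Qed.

Theorem mainTheorem5 (R : realType) :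
  (exists K : R, 0 < K /\
    forall (T : finType) (e : rel T) (d : nat),
      simple_graph e -> connected_graph e -> regular_graph e d ->
      (max_hitting_time R e <=
        (K * #|T|%:R ^+ 2 *
          (ln d%:R / d%:R + 1 / (edge_connectivity e)%:R))%:E)%E) /\
  (exists K : R, 0 < K /\
    forall (T : finType) (e : rel T) (d : nat),
      simple_graph e -> connected_graph e -> regular_graph e d ->
      (2 <= d)%N ->
      (max_hitting_time R e <=
        (K * #|T|%:R ^+ 2 * (ln d%:R / (edge_connectivity e)%:R))%:E)%E).
Proof.
split.
  exists 72; split => // T e d sg conn reg.
  apply: le_trans (max_hitting_time_le R sg conn reg) _; rewrite lee_fin -mulrA.
  rewrite -[leRHS]mulrA ler_pM2l // ler_wpM2l ?exprn_ge0 // div1r lerDr.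
  case: d reg => [|d] _; first by rewrite ln0 // mul0r.
  by rewrite divr_ge0 // ln_ge0 // ler1n.
have ln2 : 0 < ln 2 :> R by rewrite ln_gt0 // ltr1n.
exists (72 / ln 2); split => [|T e d sg conn reg d2]; first by rewrite divr_gt0.
apply: le_trans (max_hitting_time_le R sg conn reg) _; rewrite lee_fin.
have -> : 72 / ln 2 * #|T|%:R ^+ 2 * (ln d%:R / (edge_connectivity e)%:R) =
    72 * #|T|%:R ^+ 2 / (edge_connectivity e)%:R * (ln d%:R / ln 2) :> R.
  by rewrite mulrA [_ / (edge_connectivity e)%:R * _]mulrAC; congr (_ / _); ring.
rewrite ler_peMr ?divr_ge0 ?mulr_ge0 ?exprn_ge0 //.
by rewrite ler_pdivlMr // mul1r ler_ln ?posrE ?ltr0n ?ler_nat //; lia.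
Qed.
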